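(* There is an absolute constant $c>0$ such that for every finite set $A\subset\mathbb{R}$ with $|A|\ge 2$, writing $D:=A-A$, the following hold. Both $|DD|$ and $|D/D|$ are at least $$c\,|D|^{\frac56}\,|R[A]|^{\frac14},$$ and moreover $$|D|^{\frac56}\,|R[A]|^{\frac14}\ \ge\ c\,|D|^{\frac56}\,|A|^{\frac12}(\log|A|)^{-\frac14}.$$ In particular, both $|DD|$ and $|D/D|$ are at least $$c\,|D|^{1+\frac1{12}}(\log|D|)^{-\frac14}.$$
   Context: For finite $X,Y\subset\mathbb{R}$: $X-Y=\{x-y: x\in X,\,y\in Y\}$, $XY=\{xy: x\in X,\,y\in Y\}$, $X/Y=\{x/y: x\in X,\,y\in Y,\,y\ne 0\}$. For a finite set $A$ with $|A|\ge2$, $$R[A]=\left\{\frac{a_2-a}{a_1-a}: a,a_1,a_2\in A,\ a_1\ne a\right\}.$$ $|\cdot|$ denotes cardinality. Logarithms are to base $2$. *)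

(* Defs.v *)
From HB Require Import structures.
From mathcomp Require Import all_boot all_order all_algebra.
From mathcomp Require Import finmap.
From mathcomp Require Import all_classical all_reals all_analysis.

Set Implicit Arguments.
Unset Strict Implicit.
Unset Printing Implicit Defensive.

Import Order.TTheory GRing.Theory Num.Theory.
Local Open Scope fset_scope.
Local Open Scope ring_scope.

Definition diff_set (R : realType) (X Y : {fset R}) : {fset R} :=
  [fset x - y | x in X, y in Y].

Definition prod_set (R : realType) (X Y : {fset R}) : {fset R} :=
  [fset x * y | x in X, y in Y].

(* [x / 0 = 0] in the library, so zero denominators are excluded explicitly. *)
Definition quot_set (R : realType) (X Y : {fset R}) : {fset R} :=
  [fset x / y | x in X, y in Y & y != 0].

Definition ratio_set (R : realType) (A : {fset R}) : {fset R} :=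
  \bigcup_(a <- A) [fset (a2 - a) / (a1 - a) | a2 in A, a1 in A & a1 != a].

Definition log2 (R : realType) (x : R) : R := ln x / ln 2.

Lemma diff_setP (R : realType) (X Y : {fset R}) (z : R) :
  reflect (exists x y, [/\ x \in X, y \in Y & z = x - y]) (z \in diff_set X Y).
Proof.
apply: (iffP (imfset2P _ _ _ _ _)) => [[x xX [y yY ->]]|[x [y [xX yY ->]]]].
  by exists x, y.
by exists x => //; exists y.
Qed.

Lemma prod_setP (R : realType) (X Y : {fset R}) (z : R) :
  reflect (exists x y, [/\ x \in X, y \in Y & z = x * y]) (z \in prod_set X Y).
Proof.
apply: (iffP (imfset2P _ _ _ _ _)) => [[x xX [y yY ->]]|[x [y [xX yY ->]]]].
  by exists x, y.
by exists x => //; exists y.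
Qed.

Lemma quot_setP (R : realType) (X Y : {fset R}) (z : R) :
  reflect (exists x y, [/\ x \in X, y \in Y, y != 0 & z = x / y])
          (z \in quot_set X Y).
Proof.
apply: (iffP (imfset2P _ _ _ _ _)).
  by move=> [x xX [y /andP[yY y0] ->]]; exists x, y.
by move=> [x [y [xX yY y0 ->]]]; exists x => //; exists y => //; apply/andP.
Qed.

Lemma ratio_setP (R : realType) (A : {fset R}) (z : R) :
  reflect (exists a a1 a2, [/\ [/\ a \in A, a1 \in A & a2 \in A], a1 != a
             & z = (a2 - a) / (a1 - a)])
          (z \in ratio_set A).
Proof.
apply: (iffP (bigfcupP _ _ _ _)).
  move=> [a /andP[aA _] /imfset2P[a2 a2A [a1 /andP[a1A a1a] ->]]].
  by exists a, a1, a2.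
move=> [a [a1 [a2 [[aA a1A a2A] a1a ->]]]]; exists a; first by rewrite aA.
by apply/imfset2P; exists a2 => //; exists a1 => //; apply/andP.
Qed.

(* Main.v *)
(* Cut the n x n grid X x X into cells of w x w points.  A line with nonzero slope meets O(n / w) cells, so with w of order n / k a line with k points has at least k / 2 pairs of points in a common cell.  There are only n^2 w^2 such pairs, hence at most O(n^4 / k^3) such lines: this case of the Szemeredi-Trotter theorem is all that is needed.

   Every r in R[A] satisfies r = d1 / d2 and 1 - r = d3 / d2 with d1, d2, d3 in D.  Let B be D \ {0} or the set of its inverses.  For b, c in B the line x / c + y / b = 1 contains the |R[A]| points (r c, (1 - r) b) of the square of {0} u BB/B, so |B|^2 |R[A]|^3 = O(|BB/B|^4), while |BB/B| <= K^3 |D \ {0}| with K = |(D \ {0}) B| / |D \ {0}| by Plunnecke-Ruzsa.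

   For the lower bound on |R[A]|, two equal ratios correspond to three collinear points of A x A.  Summing the bound on k-rich lines over k gives O(|A|^4 log |A|) collinear triples, and Cauchy-Schwarz concludes. *)
Require Import Defs.
From HB Require Import structures.
From mathcomp Require Import all_boot all_order all_algebra.
From mathcomp Require Import finmap.
From mathcomp Require Import all_classical all_reals all_analysis.
From mathcomp Require Import ring lra zify.

Set Implicit Arguments.
Unset Strict Implicit.

Import Order.TTheory GRing.Theory Num.Theory.
Local Open Scope fset_scope.
Local Open Scope ring_scope.

(** * Counting in finite sets *)

Lemma leq_card_fset_inj (K K' : choiceType) (f : K -> K')
    (A : {fset K}) (B : {fset K'}) :
  {in A &, injective f} -> (forall x, x \in A -> f x \in B) ->
  (#|` A| <= #|` B|)%N.
Proof.
move=> fI fAB; have <- : #|` f @` A| = #|` A| by rewrite card_in_imfset.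
apply: fsubset_leq_card; apply/fsubsetP => _ /imfsetP[x /= xA ->].
exact: fAB.
Qed.

Lemma cardfs_sep (K : choiceType) (A : {fset K}) (P : pred K) :
  #|` [fset x in A | P x]| = (\sum_(x <- A) P x)%N.
Proof.
rewrite card_fset_sum1 -big_fset_condE big_mkcond /=.
by apply: eq_bigr => x _; case: (P x).
Qed.

Lemma cardfs_sep_pair (K K' : choiceType) (A : {fset K}) (B : {fset K'})
    (P : K -> K' -> bool) :
  #|` [fset p in A `*` B | P p.1 p.2]| =
  (\sum_(a <- A) #|` [fset b in B | P a b]|)%N.
Proof.
rewrite cardfs_sep big_imfset2 /=; last first.
  by move=> [x y] [x' y'] _ _ /= [-> ->].
by apply: eq_bigr => a _; rewrite cardfs_sep.
Qed.

Lemma sum_fset_const (K : choiceType) (A : {fset K}) (c : nat) :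
  (\sum_(x <- A) c = #|` A| * c)%N.
Proof. by rewrite big_const_seq count_predT iter_addn_0 mulnC. Qed.

Lemma cardfs_prod (K K' : choiceType) (A : {fset K}) (B : {fset K'}) :
  #|` A `*` B| = (#|` A| * #|` B|)%N.
Proof.
rewrite card_fset_sum1 big_imfset2 /=; last first.
  by move=> [x y] [x' y'] _ _ /= [-> ->].
by rewrite -card_fset_sum1 sum_fset_const.
Qed.

(** At most [n] elements of [S] are alone in their fibre of [f], since [f] is injective on them;
    every other element is the first coordinate of a colliding pair. *)
Lemma leq_card_collisions (K : choiceType) (S : {fset K}) (f : K -> nat) n :
  (forall x, x \in S -> (f x < n)%N) ->
  (#|` S| <=
   #|` [fset p in S `*` S | (p.1 != p.2) && (f p.1 == f p.2)]| + n)%N.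
Proof.
move=> fn; set C := [fset p in _ | _].
pose lonely := [fset x in S | [forall y : S, (f (val y) == f x) ==> (val y == x)]].
have lonely_le : (#|` lonely| <= n)%N.
  have -> : n = #|` [fset i in iota 0 n]|.
    by rewrite card_fseq undup_id ?iota_uniq// size_iota.
  apply: (@leq_card_fset_inj _ _ f); last first.
    by move=> x; rewrite !inE /= mem_iota => /andP[/fn].
  move=> x y; rewrite !inE /= => /andP[xS _] /andP[_ /forallP yl] fxy.
  by have /implyP := yl [` xS]; rewrite /= fxy => /(_ (eqxx _)) /eqP.
have sub : S `<=` fst @` C `|` lonely.
  apply/fsubsetP => x xS; rewrite in_fsetU.
  have [_|] := boolP (x \in lonely); first by rewrite orbT.
  rewrite orbF !inE /= xS /= => /forallPn[y].
  rewrite negb_imply => /andP[fyx yx] /=.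
  apply/imfsetP; exists (x, val y) => //=.
  by rewrite !inE /= xS fsvalP eq_sym yx eq_sym.
apply: leq_trans (fsubset_leq_card sub) _.
by apply: leq_trans (leq_card_fsetU _ _) (leq_add (leq_imfset_card _ _ _) _).
Qed.

(** * Grid cells and rich lines *)

Lemma fproper_mem (K : choiceType) (A B : {fset K}) (x : K) :
  {subset A <= B} -> x \in B -> x \notin A -> A `<` B.
Proof.
move=> AB xB xA; rewrite fproperE; apply/andP; split; first exact/fsubsetP.
by apply: contra xA => /fsubsetP; apply.
Qed.

(** Cells are blocks of [w] consecutive elements of [X]: [g] is the rank in [X] divided by [w]. Each
    element shares its block with at most [w] elements, itself included. *)
Lemma exists_cells (R : realDomainType) (X : {fset R}) (w : nat) :
  (0 < w)%N -> exists g : R -> nat,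
  [/\ {homo g : x y / x <= y >-> (x <= y)%N},
      forall x, x \in X -> (g x <= #|` X|.-1 %/ w)%N &
      (#|` [fset p in X `*` X | g p.1 == g p.2]| <= #|` X| * w)%N].
Proof.
move=> w0; pose rank x := #|` [fset y in X | y < x]|.
have rank_homo : {homo rank : x y / x <= y >-> (x <= y)%N}.
  move=> x y xy; apply: fsubset_leq_card; apply/fsubsetP => z.
  by rewrite !inE /= => /andP[-> /lt_le_trans]; apply.
have rank_lt x y : x \in X -> x < y -> (rank x < rank y)%N.
  move=> xX xy; apply: fproper_ltn_card; apply: (@fproper_mem _ _ _ x).
  - by move=> z; rewrite !inE /= => /andP[-> /lt_trans]; apply.
  - by rewrite !inE /= xX xy.
  - by rewrite !inE /= ltxx andbF.
have rank_inj : {in X &, injective rank}.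
  move=> x y xX yX e; have [xy|yx|//] := ltgtP x y.
    by have := rank_lt _ _ xX xy; rewrite e ltnn.
  by have := rank_lt _ _ yX yx; rewrite e ltnn.
exists (fun x => rank x %/ w)%N; split=> [x y /rank_homo|x xX|].
- exact: leq_div2r.
- apply: leq_div2r; rewrite -ltnS prednK; last first.
    by rewrite cardfs_gt0; apply/fset0Pn; exists x.
  apply: fproper_ltn_card; apply: (@fproper_mem _ _ _ x) => //.
    by move=> z; rewrite !inE => /andP[].
  by rewrite !inE ltxx andbF.
rewrite (cardfs_sep_pair X X (fun x y => rank x %/ w == rank y %/ w)%N).
rewrite -sum_fset_const.
apply: leq_sum => x _.
have Ew : w = #|` [fset i in iota (rank x %/ w * w)%N w]|.
  by rewrite card_fseq undup_id ?iota_uniq// size_iota.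
rewrite [leqRHS]Ew; apply: (@leq_card_fset_inj _ _ rank) => [y z|y].
  by rewrite !inE /= => /andP[yX _] /andP[zX _]; exact: rank_inj.
rewrite !inE /= mem_iota => /andP[_ /eqP ->].
by rewrite leq_trunc_div /= {1}(divn_eq (rank y) w) ltn_add2l ltn_mod.
Qed.

Definition line_fset (R : realDomainType) (X : {fset R}) (l : R * R) :=
  [fset x in X | l.1 * x + l.2 \in X].

Lemma rich_lines (R : realDomainType) (X : {fset R}) (L : {fset R * R}) (k : nat) :
  (2 <= k)%N ->
  (forall l, l \in L -> l.1 != 0 /\ (k <= #|` line_fset X l|)%N) ->
  (#|` L| * k ^ 3 <= 162 * #|` X| ^ 4)%N.
Proof.
move=> k2 Lk; set n := #|` X|.
have [->|/fset0Pn[l0 l0L]] := eqVneq L fset0; first by rewrite cardfs0.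
have kn : (k <= n)%N.
  apply: leq_trans (proj2 (Lk _ l0L)) (fsubset_leq_card _).
  by apply/fsubsetP => x; rewrite !inE => /andP[].
(* For [4 <= k], [w] is just above [8 n / k]: then [w k <= 8 n + k <= 9 n], and [G = (n - 1) / w]
   satisfies [8 G < k], so that [2 G + 1] is at most [k / 2]. For smaller [k] a single cell,
   [w = n], suffices. *)
have [w [w0 wk wG]] : exists w,
    [/\ (0 < w)%N, (w * k <= 9 * n)%N & (2 * (2 * (n.-1 %/ w)).+1 <= k)%N].
  have [k4|k4] := leqP 4 k.
    exists (8 * n %/ k).+1; split=> //.
      by have := leq_trunc_div (8 * n) k; lia.
    have := ltn_ceil (8 * n) (leq_trans _ k2 : (0 < k)%N).
    set w := (_ %/ _).+1 => /(_ isT) hw.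
    have := leq_trunc_div n.-1 w; set G := (_ %/ _)%N => hG.
    have [->|G0] := posnP G; first by lia.
    have : (8 * G * n < k * n)%N by nia.
    by rewrite ltn_mul2r => /andP[_]; lia.
  exists n; split; [lia|nia|by rewrite divn_small; lia].
have [g [g_homo gG gP]] := exists_cells X w0.
set G := (_ %/ w)%N in gG wG.
set P := [fset p in _ | _] in gP.
(* Along a line of nonzero slope both cell coordinates are monotone. Reflecting the second one when
   the slope is negative makes both nondecreasing, so their sum, at most [2 G], identifies the cell.
   Truncated subtraction is harmless because [g <= G] on [X]. *)
pose key (l : R * R) x :=
  (g x + if (0 < l.1)%R then g (l.1 * x + l.2)%R
   else G - g (l.1 * x + l.2)%R)%N.
pose E l := [fset p in line_fset X l `*` line_fset X l |
  (p.1 != p.2) && (key l p.1 == key l p.2)].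
have cell_key l x y : l.1 != 0 -> x \in line_fset X l -> y \in line_fset X l ->
    x <= y -> key l x = key l y ->
    g x = g y /\ g (l.1 * x + l.2)%R = g (l.1 * y + l.2).
  move=> ln0; rewrite !inE /= => /andP[_ /gG xG] /andP[_ /gG yG] xy.
  have gxy := g_homo _ _ xy; rewrite /key.
  have [lp|ln|/esym/eqP] := ltgtP 0 l.1; last by rewrite (negPf ln0).
    have := g_homo (l.1 * x + l.2) (l.1 * y + l.2).
    rewrite lerD2r ler_pM2l// => /(_ xy); move: xG yG gxy.
    by move: (g x) (g y) (g _) (g _); lia.
  have := g_homo (l.1 * y + l.2) (l.1 * x + l.2).
  rewrite lerD2r ler_nM2l// => /(_ xy); move: xG yG gxy.
  by move: (g x) (g y) (g _) (g _); lia.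
have Ek l : l \in L -> (k <= 2 * #|` E l|)%N.
  move=> lL; have [_ kl] := Lk _ lL.
  have := @leq_card_collisions _ (line_fset X l) (key l) (2 * G).+1.
  suff h x : x \in line_fset X l -> (key l x < (2 * G).+1)%N.
    by move=> /(_ h); rewrite -/(E l); lia.
  rewrite !inE /= => /andP[/gG xG /gG yG]; rewrite /key.
  by case: ifP => _; lia.
have sumE : (\sum_(l <- L) #|` E l| <= #|` P `*` P|)%N.
  (* Two distinct points determine their line, so a line with a colliding pair of its points is
     recovered from the pair of abscissae and the pair of ordinates, both of which lie in [P]. *)
  pose f (q : (R * R) * (R * R)) :=
    (q.2, (q.1.1 * q.2.1 + q.1.2, q.1.1 * q.2.2 + q.1.2)).
  have -> : (\sum_(l <- L) #|` E l| =
      #|` [fset q in L `*` (X `*` X) | q.2 \in E q.1]|)%N.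
    rewrite (cardfs_sep_pair L (X `*` X) (fun l p => p \in E l)).
    apply: eq_bigr => l _; congr (#|` _|); apply/fsetP => p.
    rewrite !inE /=.
    by case: (p.1 \in X) => //=; case: (p.2 \in X); rewrite /= ?andbF.
  apply: (@leq_card_fset_inj _ _ f).
    move=> [[m b] [x y]] [[m' b'] [x' y']].
    rewrite !inE /= => /and4P[_ _ xy _] _ [<- <- ex ey].
    suff em : m = m' by move: ex; rewrite em => /addrI ->.
    by apply: (@mulIf _ (x - y)); [rewrite subr_eq0|lra].
  move=> [l [x y]]; rewrite !inE /=.
  move=> /and4P[/and3P[lL xX yX] /and3P[/andP[_ xl] _ yl] _ /eqP kxy].
  have [ln0 _] := Lk _ lL.
  have xS : x \in line_fset X l by rewrite !inE /= xX.
  have yS : y \in line_fset X l by rewrite !inE /= yX.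
  have [e1 e2] : g x = g y /\ g (l.1 * x + l.2)%R = g (l.1 * y + l.2).
    have [xley|/ltW ylex] := leP x y.
      exact: cell_key.
    by have [] := cell_key l y x ln0 yS xS ylex (esym kxy).
  by rewrite xX yX xl yl e1 e2 !eqxx.
have Lk2 : (#|` L| * k <= 2 * (n * w) ^ 2)%N.
  rewrite -sum_fset_const.
  apply: leq_trans (_ : (\sum_(l <- L) 2 * #|` E l| <= _)%N).
    by rewrite big_seq [leqRHS]big_seq; exact: leq_sum.
  rewrite -big_distrr /= leq_mul2l /= (leq_trans sumE)// cardfs_prod.
  by rewrite -mulnn leq_mul.
(* The extra factor [k ^ 2] is absorbed by [w k <= 9 n], and [162 = 2 * 9 ^ 2]. *)
have -> : (#|` L| * k ^ 3 = #|` L| * k * k ^ 2)%N by ring.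
apply: leq_trans (leq_mul Lk2 (leqnn _)) _.
have -> : (2 * (n * w) ^ 2 * k ^ 2 = 2 * n ^ 2 * (w * k) ^ 2)%N by ring.
have -> : (162 * n ^ 4 = 2 * n ^ 2 * (9 * n) ^ 2)%N by ring.
by rewrite leq_mul2l leq_exp2r // wk orbT.
Qed.

(** * Multiplicative Plunnecke-Ruzsa inequality *)

Lemma mem_prod_set (R : realType) (X Y : {fset R}) (x y : R) :
  x \in X -> y \in Y -> x * y \in prod_set X Y.
Proof. by move=> xX yY; apply/prod_setP; exists x, y. Qed.

Lemma prod_setS (R : realType) (X X' Y Y' : {fset R}) :
  X `<=` X' -> Y `<=` Y' -> prod_set X Y `<=` prod_set X' Y'.
Proof.
move=> /fsubsetP XX' /fsubsetP YY'.
apply/fsubsetP => _ /prod_setP[x [y [xX yY ->]]].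
by rewrite mem_prod_set ?XX' ?YY'.
Qed.

(* Petridis's lemma, by induction on [C]: adjoining [c] to [C], the elements [x] of [X] with [x c] in the old [X C] contribute nothing new to either side, and minimality of [|X B| / |X|] is applied to the set of such [x]. *)
Lemma petridis (R : realType) (X B C : {fset R}) : 0 \notin C ->
  (forall Z, Z `<=` X ->
    #|` prod_set X B| * #|` Z| <= #|` prod_set Z B| * #|` X|)%N ->
  (#|` prod_set (prod_set X B) C| * #|` X| <=
   #|` prod_set X B| * #|` prod_set X C|)%N.
Proof.
move=> C0 minX; elim/finSet_rect: C C0 => C IH C0.
have [->|/fset0Pn[c cC]] := eqVneq C fset0.
  suff -> : prod_set (prod_set X B) fset0 = fset0 by rewrite cardfs0.
  by apply/fsetP => z; rewrite inE; apply/prod_setP => -[x [y []]].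
have c0 : c != 0 by apply: contraNneq C0 => <-.
set C' := C `\ c.
have C'C : C' `<=` C by exact: fsubD1set.
have {}IH := IH C' (fproperD1 cC) (contra (fsubsetP C'C 0) C0).
pose W := [fset x in X | x * c \in prod_set X C'].
have WX : W `<=` X by apply/fsubsetP => x; rewrite !inE => /andP[].
have WB : prod_set W B `<=` prod_set X B by exact: prod_setS.
have cI : injective ( *%R^~ c) by exact: mulIf.
have card_c (S : {fset R}) : #|` *%R^~ c @` S| = #|` S|.
  by rewrite card_imfset.
have up : (#|` prod_set (prod_set X B) C| <= #|` prod_set (prod_set X B) C'| +
    (#|` prod_set X B| - #|` prod_set W B|))%N.
  rewrite -cardfsDS// -(card_c (_ `\` _)).
  apply: leq_trans (leq_card_fsetU _ _); apply: fsubset_leq_card.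
  apply/fsubsetP => _ /prod_setP[_ [c' [/prod_setP[x [b [xX bB ->]]] c'C ->]]].
  rewrite in_fsetU; have [->|cc'] := eqVneq c' c; last first.
    by rewrite !mem_prod_set// !inE cc'.
  have [|xbW] := boolP (x * b \in prod_set W B); last first.
    apply/orP; right; apply/imfsetP; exists (x * b) => //=.
    by rewrite in_fsetD xbW mem_prod_set.
  move=> /prod_setP[x' [b' [+ b'B ->]]]; rewrite !inE /= => /andP[_].
  move=> /prod_setP[y [d [yX dC' e]]].
  by rewrite mulrAC e mulrAC !mem_prod_set.
have low : (#|` prod_set X C'| + (#|` X| - #|` W|) <= #|` prod_set X C|)%N.
  rewrite -cardfsDS// -(card_c (_ `\` _)) -cardfsUI.
  rewrite [X in (_ + #|` X|)%N](_ : _ = fset0); last first.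
    apply/fsetP => z; rewrite inE in_fset0; apply/negP => /andP[zXC].
    move=> /imfsetP[x /=]; rewrite in_fsetD => /andP[+ xX] zE.
    by rewrite !inE /= xX -zE zXC.
  rewrite cardfs0 addn0; apply: fsubset_leq_card.
  rewrite fsubUset prod_setS//=; apply/fsubsetP => _ /imfsetP[x /= + ->].
  by rewrite in_fsetD => /andP[_ xX]; rewrite mem_prod_set.
have := minX W WX; have := fsubset_leq_card WX; have := fsubset_leq_card WB.
move: up low IH; nia.
Qed.

(** Fix one representation [q = y / z] for each [q]. The map from [(q, x)] to [(x y, x z)] is
    injective: the quotient of the images gives [q], hence [z], and then [x]. *)
Lemma ruzsa_triangle (R : realType) (X Y Z Q : {fset R}) :
  0 \notin X -> 0 \notin Z ->
  (forall q, q \in Q -> exists y z, [/\ y \in Y, z \in Z & q = y / z]) ->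
  (#|` Q| * #|` X| <= #|` prod_set X Y| * #|` prod_set X Z|)%N.
Proof.
move=> X0 Z0 QP; rewrite -!cardfs_prod.
have /choice[f fP] : forall q, exists p : R * R, q \in Q ->
    [/\ p.1 \in Y, p.2 \in Z & q = p.1 / p.2].
  move=> q; have [/QP[y [z qP]]|] := boolP (q \in Q); first by exists (y, z).
  by exists (0, 0).
have nz (A : {fset R}) x : 0 \notin A -> x \in A -> x != 0.
  by move=> A0 xA; apply: contraNneq A0 => <-.
apply: (@leq_card_fset_inj _ _ (fun p => (p.2 * (f p.1).1, p.2 * (f p.1).2))).
  move=> [q x] [q' x']; rewrite !inE /= => /andP[qQ xX] /andP[qQ' xX'] [e1 e2].
  have [_ zZ qE] := fP _ qQ; have [_ zZ' qE'] := fP _ qQ'.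
  have z0 := nz _ _ Z0 zZ; have z0' := nz _ _ Z0 zZ'.
  have x0 := nz _ _ X0 xX; have x0' := nz _ _ X0 xX'.
  have quotE (u y z : R) : u != 0 -> z != 0 -> y / z = (u * y) / (u * z).
    by move=> u0 w0; field; rewrite u0 w0.
  have eq : q = q' by rewrite qE (quotE x)// e1 e2 -(quotE x')// -qE'.
  by move: e2; rewrite eq => /(mulIf z0') ->.
move=> [q x]; rewrite !inE /= => /andP[/fP[yY zZ _] xX].
by rewrite !mem_prod_set.
Qed.

(** Let [X] minimise [|XB| / |X|] over the nonempty subsets of [A]. Petridis's lemma gives
    [|XBB| |X| <= |XB|^2], the triangle inequality gives [|Q| |X| <= |XBB| |XB|], and minimality
    replaces [|XB| / |X|] by [|AB| / |A|]; [|X| <= |A|] finishes. *)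
Lemma plunnecke_ruzsa (R : realType) (A B : {fset R}) :
  0 \notin A -> 0 \notin B -> A != fset0 ->
  (#|` quot_set (prod_set B B) B| * #|` A| ^ 2 <= #|` prod_set A B| ^ 3)%N.
Proof.
move=> A0 B0 An0; set Q := quot_set _ _.
have QP q : q \in Q -> exists y z, [/\ y \in prod_set B B, z \in B & q = y / z].
  by move=> /quot_setP[y [z [yB zB _ ->]]]; exists y, z.
have [X [XA Xn0 minX]] : exists X, [/\ X `<=` A, X != fset0 & forall Z,
    Z `<=` A -> #|` prod_set X B| * #|` Z| <= #|` prod_set Z B| * #|` X|]%N.
  pose F (Z : fpowerset A) : rat :=
    #|` prod_set (val Z) B|%:R / #|` val Z|%:R.
  have AA : A \in fpowerset A by rewrite fpowersetE.
  have := @arg_minP _ _ _ [` AA] (fun Z => val Z != fset0) F An0.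
  case=> X Xn0 Xmin; exists (val X); split=> // [|Z ZA].
    by rewrite -fpowersetE fsvalP.
  have [->|Zn0] := eqVneq Z fset0; first by rewrite cardfs0 muln0.
  have Zp : Z \in fpowerset A by rewrite fpowersetE.
  have := Xmin [` Zp] Zn0; rewrite /F /=.
  rewrite ler_pdivrMr ?ltr0n ?cardfs_gt0// mulrAC ler_pdivlMr ?ltr0n ?cardfs_gt0//.
  by rewrite -!natrM ler_nat.
have X0 : 0 \notin X by apply: contra A0; exact: fsubsetP.
have mX Z : Z `<=` X ->
    (#|` prod_set X B| * #|` Z| <= #|` prod_set Z B| * #|` X|)%N.
  by move=> /fsubset_trans /(_ XA); exact: minX.
have pet := petridis B0 mX.
have := ruzsa_triangle X0 B0 QP.
have -> : prod_set X (prod_set B B) = prod_set (prod_set X B) B.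
  apply/fsetP => z; apply/prod_setP/prod_setP.
    move=> [x [_ [xX /prod_setP[b [b' [bB bB' ->]]] ->]]].
    by exists (x * b), b'; rewrite mulrA mem_prod_set.
  move=> [_ [b' [/prod_setP[x [b [xX bB ->]]] bB' ->]]].
  by exists x, (b * b'); rewrite mulrA mem_prod_set.
have min := minX A (fsubset_refl A).
have := fsubset_leq_card XA; have : (0 < #|` X|)%N by rewrite cardfs_gt0.
move: pet min; set q := #|` Q|; set a := #|` A|; set x := #|` X|.
set p := #|` prod_set X B|; set t := #|` prod_set A B|.
set s := #|` prod_set (prod_set X B) B| => pet min x0 xa tri.
have tri2 : (q * x ^ 2 <= p ^ 3)%N.
  have -> : (q * x ^ 2 = q * x * x)%N by ring.
  have -> : (p ^ 3 = p * p * p)%N by ring.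
  apply: leq_trans (leq_mul tri (leqnn x)) _.
  by rewrite mulnAC leq_mul2r pet orbT.
have h : (q * a ^ 3 * x ^ 2 <= t ^ 3 * x * x ^ 2)%N.
  have -> : (q * a ^ 3 * x ^ 2 = q * x ^ 2 * a ^ 3)%N by ring.
  have -> : (t ^ 3 * x * x ^ 2 = (t * x) ^ 3)%N by ring.
  apply: leq_trans (leq_mul tri2 (leqnn _)) _.
  by rewrite -expnMn leq_exp2r.
move: h; rewrite leq_pmul2r ?expn_gt0 ?x0//= => h.
have a0 := leq_trans x0 xa.
rewrite -(leq_pmul2r a0).
by apply: leq_trans (leq_trans _ h) _; [lia|rewrite leq_mul2l xa orbT].
Qed.

(** * Incidences produced by ratios *)

Definition ratio_or_zero (R : realType) (B : {fset R}) (r : R) :=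
  r = 0 \/ exists b b', [/\ b \in B, b' \in B & r = b / b'].

Lemma card_ratio_incidence (R : realType) (B S : {fset R}) :
  0 \notin B -> B != fset0 -> (2 <= #|` S|)%N ->
  (forall r, r \in S -> ratio_or_zero B r /\ ratio_or_zero B (1 - r)) ->
  (#|` B| ^ 2 * #|` S| ^ 3 <=
   2592 * #|` quot_set (prod_set B B) B| ^ 4)%N.
Proof.
move=> B0 Bn0 S2 SB; set Q := quot_set _ _.
have nz b : b \in B -> b != 0 by move=> bB; apply: contraNneq B0 => <-.
have Q0 : (0 < #|` Q|)%N.
  have [b bB] := fset0Pn _ Bn0; rewrite cardfs_gt0; apply/fset0Pn.
  exists (b * b / b); apply/quot_setP; exists (b * b), b.
  by rewrite nz// mem_prod_set.
pose X := 0 |` Q.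
have XQ : (#|` X| <= 2 * #|` Q|)%N
  by rewrite cardfsU1 mul2n -addnn leq_add2r (leq_trans (leq_b1 _)).
have rX r b : ratio_or_zero B r -> b \in B -> r * b \in X.
  move=> [->|[d [d' [dB d'B ->]]]] bB; first by rewrite mul0r fset1U1.
  apply/fset1UP; right; apply/quot_setP; exists (d * b), d'.
  by rewrite nz// mem_prod_set// mulrAC.
(* [x / c + y / b = 1] in slope-intercept form *)
pose line (p : R * R) := (- (p.1 / p.2), p.1).
have line_inj : {in B `*` B &, injective line}.
  move=> [b c] [b' c']; rewrite !inE /= => /andP[bB cB] /andP[_ c'B] [e1 e2].
  move: e1; rewrite -e2 => /oppr_inj /(mulfI (nz _ bB)) /invr_inj -> //.
have cardL : #|` line @` (B `*` B)| = (#|` B| ^ 2)%N.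
  by rewrite card_in_imfset //= cardfs_prod mulnn.
have := @rich_lines _ X (line @` (B `*` B)) #|` S| S2.
rewrite cardL => h; apply: leq_trans (h _) _; last first.
  (* Adjoining 0 at most doubles [Q], whence [2592 = 162 * 2 ^ 4]. *)
  have -> : (2592 * #|` Q| ^ 4 = 162 * (2 * #|` Q|) ^ 4)%N by ring.
  by rewrite leq_mul2l leq_exp2r.
move=> l /imfsetP[[b c] /=]; rewrite !inE /= => /andP[bB cB] -> /=.
have b0 := nz _ bB; have c0 := nz _ cB.
split; first by rewrite oppr_eq0 mulf_neq0// invr_eq0.
(* The abscissae [r * c] with [r] in [S] are distinct, and the ordinate there is [(1 - r) * b]. *)
apply: (@leq_card_fset_inj _ _ ( *%R^~ c)) => [r r' _ _|r /SB[rB r1B]].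
  exact: mulIf.
have -> : (r * c \in line_fset X (line (b, c))) =
    (r * c \in X) && (- (b / c) * (r * c) + b \in X) by rewrite !inE.
have -> : - (b / c) * (r * c) + b = (1 - r) * b by field.
by rewrite !rX.
Qed.

(** The fourth power of Plunnecke-Ruzsa, [|BB/B|^4 |A|^8 <= |AB|^12], eliminates [|BB/B|] from the
    incidence bound. Keeping [A] and [B] separate lets [AB] be a product set or a quotient set. *)
Lemma card_ratio_product (R : realType) (A B S : {fset R}) :
  0 \notin A -> 0 \notin B -> A != fset0 -> #|` A| = #|` B| ->
  (2 <= #|` S|)%N ->
  (forall r, r \in S -> ratio_or_zero B r /\ ratio_or_zero B (1 - r)) ->
  (#|` A| ^ 10 * #|` S| ^ 3 <= 2592 * #|` prod_set A B| ^ 12)%N.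
Proof.
move=> A0 B0 An0 AB S2 SB.
have Bn0 : B != fset0 by rewrite -cardfs_gt0 -AB cardfs_gt0.
have := card_ratio_incidence B0 Bn0 S2 SB; rewrite -AB.
have := plunnecke_ruzsa A0 B0 An0.
set q := #|` _|; set a := #|` A|; set t := #|` prod_set A B|.
set s := #|` S| => qt sq.
have -> : (a ^ 10 * s ^ 3 = a ^ 8 * (a ^ 2 * s ^ 3))%N by ring.
apply: leq_trans (leq_mul (leqnn _) sq) _.
have -> : (a ^ 8 * (2592 * q ^ 4) = 2592 * (q * a ^ 2) ^ 4)%N by ring.
have -> : (t ^ 12 = (t ^ 3) ^ 4)%N by ring.
by rewrite leq_mul2l leq_exp2r.
Qed.

(** * Application to the difference set *)

Section DifferenceSet.

Variables (R : realType) (A : {fset R}).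
Hypothesis A2 : (2 <= #|` A|)%N.
Let D := diff_set A A.
Let D' := D `\ 0.

Let pair_in_A : exists a b, [/\ a \in A, b \in A & a != b].
Proof.
have [a aA] : exists a, a \in A by apply/fset0Pn; rewrite -cardfs_gt0; lia.
have [b] : exists b, b \in A `\ a.
  by apply/fset0Pn; rewrite -cardfs_gt0; have := cardfsD1 a A; rewrite aA; lia.
by rewrite !inE => /andP[ba bA]; exists a, b; rewrite eq_sym.
Qed.

Lemma leq_card_diff_set : (#|` A| <= #|` diff_set A A|)%N.
Proof.
have [a [_ [aA _ _]]] := pair_in_A.
apply: (@leq_card_fset_inj _ _ (fun x => x - a)) => [x y _ _ /addIr //|x xA].
by apply/diff_setP; exists x, a.
Qed.

Lemma card_diff_set_leq : (#|` diff_set A A| <= #|` A| ^ 2)%N.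
Proof.
rewrite -mulnn -cardfs_prod.
have sub : diff_set A A `<=` (fun p => p.1 - p.2) @` (A `*` A).
  apply/fsubsetP => _ /diff_setP[x [y [xA yA ->]]].
  by apply/imfsetP; exists (x, y); rewrite //= !inE xA.
by apply: leq_trans (fsubset_leq_card sub) (leq_imfset_card _ _ _).
Qed.

Lemma card_ratio_set_ge2 : (2 <= #|` ratio_set A|)%N.
Proof.
have [a [b [aA bA ab]]] := pair_in_A.
have <- : #|` [fset (0 : R); 1]| = 2%N by rewrite cardfs2 eq_sym oner_neq0.
apply: fsubset_leq_card; apply/fsubsetP => _ /fset2P[]->; apply/ratio_setP.
  by exists a, b, a; rewrite eq_sym subrr mul0r.
by exists a, b, b; rewrite eq_sym divff// subr_eq0 eq_sym.
Qed.

Let ratio_set_D' r : r \in ratio_set A ->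
  ratio_or_zero D' r /\ ratio_or_zero D' (1 - r).
Proof.
have memD' x y : x \in A -> y \in A -> x != y -> x - y \in D'.
  by move=> xA yA xy; rewrite !inE subr_eq0 xy; apply/diff_setP; exists x, y.
move=> /ratio_setP[a [a1 [a2 [[aA a1A a2A] a1a ->]]]].
have a10 : a1 - a != 0 by rewrite subr_eq0.
split.
  have [->|a2a] := eqVneq a2 a; first by left; rewrite subrr mul0r.
  by right; exists (a2 - a), (a1 - a); rewrite !memD'.
have -> : 1 - (a2 - a) / (a1 - a) = (a1 - a2) / (a1 - a) by field.
have [->|a12] := eqVneq a1 a2; first by left; rewrite subrr mul0r.
by right; exists (a1 - a2), (a1 - a); rewrite !memD'.
Qed.

Let D'0 : 0 \notin D'. Proof. by rewrite !inE eqxx. Qed.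

(** Since [|D| >= |A| >= 2], discarding zero at most halves [D]. *)
Let card_D' : (#|` D| <= 2 * #|` D'|)%N.
Proof.
have := cardfsD1 0 D; have := leq_card_diff_set; rewrite -/D -/D'.
move: A2 (leq_b1 (0 \in D)).
by move: #|` A| #|` D| #|` D'| (nat_of_bool _) => a d d' b; lia.
Qed.

Let D'n0 : D' != fset0.
Proof.
by rewrite -cardfs_gt0; have := card_D'; have := leq_card_diff_set; rewrite -/D; lia.
Qed.

(** Passing from [D'] to [D] costs [2 ^ 10], and [2592 <= 2 ^ 12]. *)
Let leq_D_D' s t T : (#|` D'| ^ 10 * s <= 2592 * t ^ 12)%N -> (t <= T)%N ->
  (#|` D| ^ 10 * s <= 2 ^ 22 * T ^ 12)%N.
Proof.
move=> h tT; apply: leq_trans (_ : (2 ^ 10 * (#|` D'| ^ 10 * s) <= _)%N).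
  by rewrite mulnA -expnMn leq_mul// leq_exp2r.
apply: leq_trans (leq_mul (leqnn _) h) _; rewrite -[22%N]/(10 + 12)%N expnD -mulnA.
by rewrite leq_mul2l /= leq_mul ?leq_exp2r.
Qed.

Lemma card_diff_set_prod : (#|` diff_set A A| ^ 10 * #|` ratio_set A| ^ 3 <=
  2 ^ 22 * #|` prod_set (diff_set A A) (diff_set A A)| ^ 12)%N.
Proof.
apply: leq_D_D' (card_ratio_product D'0 D'0 D'n0 _ card_ratio_set_ge2
  ratio_set_D') _ => //.
by apply: fsubset_leq_card; apply: prod_setS; exact: fsubD1set.
Qed.

Lemma card_diff_set_quot : (#|` diff_set A A| ^ 10 * #|` ratio_set A| ^ 3 <=
  2 ^ 22 * #|` quot_set (diff_set A A) (diff_set A A)| ^ 12)%N.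
Proof.
(* With inverses as second factor the product set lies in [D / D], while [b / b' = b'^-1 / b^-1]
   preserves the ratios. *)
pose B := GRing.inv @` D'.
have memB d : d \in D' -> d^-1 \in B by move=> dD; apply/imfsetP; exists d.
have B0 : 0 \notin B.
  by apply: contra D'0 => /imfsetP[d /= dD /esym/eqP]; rewrite invr_eq0 => /eqP <-.
have cardB : #|` D'| = #|` B|.
  by apply: esym; apply: card_imfset; exact: invr_inj.
have ratioB r : ratio_or_zero D' r -> ratio_or_zero B r.
  move=> [|[b [b' [bD b'D ->]]]]; first by left.
  by right; exists b'^-1, b^-1; rewrite !memB// invrK mulrC.
apply: leq_D_D' (card_ratio_product D'0 B0 D'n0 cardB card_ratio_set_ge2 _) _.
  by move=> r /ratio_set_D'[? ?]; split; exact: ratioB.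
apply: fsubset_leq_card; apply/fsubsetP => _ /prod_setP[x [_ [+ /imfsetP[y /= + ->] ->]]].
rewrite !in_fsetD1 => /andP[_ xD] /andP[y0 yD].
by apply/quot_setP; exists x, y.
Qed.

End DifferenceSet.

(** * Collinear triples and the lower bound on the ratio set *)

(** Cauchy-Schwarz for the fibre sizes [N v], whose sum is [|S|] and whose squares count the pairs
    with equal image. *)
Lemma card_fibers_sqr (K K' : choiceType) (S : {fset K}) (f : K -> K') :
  (#|` S| ^ 2 <=
   #|` f @` S| * #|` [fset p in S `*` S | f p.1 == f p.2]|)%N.
Proof.
pose N v := (\sum_(x <- S | f x == v) 1)%N.
have -> : #|` S| = (\sum_(v <- f @` S) N v)%N.
  by rewrite card_fset_sum1 (partition_big_imfset _ f).
have -> : #|` [fset p in S `*` S | f p.1 == f p.2]| =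
    (\sum_(v <- f @` S) N v * N v)%N.
  rewrite (cardfs_sep_pair S S (fun x y => f x == f y)).
  rewrite (partition_big_imfset _ f) /=; apply: eq_bigr => v _.
  rewrite {1}/N big_distrl /=; apply: eq_bigr => x /eqP <-.
  rewrite mul1n cardfs_sep /N [RHS]big_mkcond /=.
  by apply: eq_bigr => y _; rewrite eq_sym; case: eqP.
(* After doubling, the claim is [2 N v N w <= N v ^ 2 + N w ^ 2] summed over all [v] and [w]. *)
set F := f @` S; rewrite -(leq_pmul2l (isT : 0 < 2)%N).
have -> : ((\sum_(v <- F) N v) ^ 2 = \sum_(v <- F) \sum_(w <- F) N v * N w)%N.
  by rewrite -mulnn big_distrl /=; apply: eq_bigr => v _; rewrite big_distrr.
have -> : (2 * (#|` F| * \sum_(v <- F) N v * N v) =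
    \sum_(v <- F) \sum_(w <- F) (N v * N v + N w * N w))%N.
  under [RHS]eq_bigr do rewrite big_split /= sum_fset_const.
  by rewrite big_split /= sum_fset_const -big_distrr /= addnn mul2n.
rewrite big_distrr /=; apply: leq_sum => v _; rewrite big_distrr /=.
by apply: leq_sum => w _; rewrite !mulnn; exact: nat_Cauchy.
Qed.

(** Each increment [j ^ 3 - (j - 1) ^ 3] is at most [3 j ^ 2]. The condition [j <= k] appears as a
    factor, so that the range does not depend on [k] and the sum can be exchanged with one over
    lines. *)
Lemma leq_cube_sum (k n : nat) : (k <= n)%N ->
  (k ^ 3 <= \sum_(1 <= j < n.+1) 3 * j ^ 2 * (j <= k))%N.
Proof.
elim: n => [|n IH] in k *; first by rewrite leqn0 => /eqP ->.
rewrite leq_eqVlt big_nat_recr //= => /orP[/eqP ->|]; last first.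
  by rewrite ltnS => /IH kn; apply: leq_trans kn (leq_addr _ _).
rewrite leqnn muln1; apply: leq_trans (_ : (n ^ 3 + 3 * n.+1 ^ 2 <= _)%N).
  by rewrite -addn1; nia.
rewrite leq_add2r; apply: leq_trans (IH n (leqnn n)) _.
by apply: leq_sum => j _; rewrite leq_mul//; case: (leqP j n) => // /leqW ->.
Qed.

(** The cubes are bounded by the sum of [3 j ^ 2 N j], with [N j] the number of lines having at
    least [j] points; [N j <= 162 n ^ 4 / j ^ 3] leaves a harmonic sum with factor
    [486 = 3 * 162]. *)
Lemma sum_line_cubes (R : realFieldType) (X : {fset R}) (L : {fset R * R}) :
  (forall l, l \in L -> l.1 != 0 /\ (2 <= #|` line_fset X l|)%N) ->
  (\sum_(l <- L) #|` line_fset X l| ^ 3)%:R <=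
    486 * #|` X|%:R ^+ 4 * \sum_(1 <= j < #|` X|.+1) (j%:R)^-1 :> R.
Proof.
move=> L2; set n := #|` X|; set k := fun l => #|` line_fset X l|.
have kn l : (k l <= n)%N.
  by apply: fsubset_leq_card; apply/fsubsetP => x; rewrite !inE => /andP[].
pose N j := #|` [fset l in L | (j <= k l)%N]|.
have NP j : (0 < j)%N -> (N j * j ^ 3 <= 162 * n ^ 4)%N.
  (* The bound on rich lines starts at two points; for [j = 1] it is applied with [k = 2], as every
     line of [L] has two points. *)
  move=> j0; have [j1|j1] := leqP j 1.
    have -> : j = 1%N by lia.
    rewrite muln1; apply: leq_trans (_ : (#|` L| * 2 ^ 3 <= _)%N).
      apply: leq_trans (_ : (#|` L| <= _)%N); last by rewrite leq_pmulr.
      by apply: fsubset_leq_card; apply/fsubsetP => x; rewrite !inE => /andP[].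
    exact: rich_lines.
  apply: rich_lines => // l; rewrite !inE => /andP[lL ->].
  by split=> //; have [] := L2 _ lL.
have le_sum : (\sum_(l <- L) k l ^ 3 <=
    \sum_(1 <= j < n.+1) 3 * j ^ 2 * N j)%N.
  apply: leq_trans (leq_sum _ (fun l _ => leq_cube_sum (kn l))) _.
  rewrite exchange_big /=; apply: leq_sum => j _.
  by rewrite -big_distrr /= /N cardfs_sep.
apply: le_trans (_ : (\sum_(1 <= j < n.+1) 3 * j ^ 2 * N j)%:R <= _).
  by rewrite ler_nat.
rewrite natr_sum big_distrr /= big_nat [leRHS]big_nat.
apply: ler_sum => j /andP[j0 _].
have j0' : 0 < j%:R :> R by rewrite ltr0n.
rewrite ler_pdivlMr//.
have := NP j j0; rewrite -(ler_nat R) !(natrX, natrM); lra.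
Qed.

Lemma sum_inv_le_ln (R : realType) (n : nat) :
  \sum_(1 <= j < n.+2) (j%:R)^-1 <= 1 + ln n.+1%:R :> R.
Proof.
elim: n => [|n IH]; first by rewrite big_nat1 invr1 ln1 addr0.
rewrite big_nat_recr //=; apply: le_trans (lerD IH (lexx _)) _.
rewrite -addrA lerD2l -lerBrDl.
have n1 : 0 < n.+1%:R :> R by rewrite ltr0n.
have n2 : 0 < n.+2%:R :> R by rewrite ltr0n.
(* The new term is compared through [ln ((n+2)/(n+1)) = - ln (1 - 1/(n+2)) >= 1/(n+2)]. *)
rewrite -ln_div ?posrE// -[leRHS]opprK lerNr -lnV ?posrE ?divr_gt0// invf_div.
have -> : n.+1%:R / n.+2%:R = 1 + - n.+2%:R^-1 :> R.
  by rewrite -[n.+1%:R](addrK 1) natr1 mulrBl divff ?lt0r_neq0// mul1r.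
by apply: le_ln1Dx; rewrite ltrN2 invf_lt1 ?ltr1n.
Qed.

(* Two triples with the same ratio [(a2 - a) / (a1 - a) = (b2 - b) / (b1 - b)] are exactly a triple of collinear points [(a, b), (a1, b1), (a2, b2)] of the grid. *)
Lemma card_triples_ratio (R : realType) (A : {fset R}) : (2 <= #|` A|)%N ->
  exists L : {fset R * R},
  (forall l, l \in L -> l.1 != 0 /\ (2 <= #|` line_fset A l|)%N) /\
  ((#|` A| * (#|` A|.-1 * #|` A|)) ^ 2 <=
   #|` ratio_set A| * \sum_(l <- L) #|` line_fset A l| ^ 3)%N.
Proof.
move=> A2.
pose line (a a1 b b1 : R) :=
  ((b1 - b) / (a1 - a), b - (b1 - b) / (a1 - a) * a).
have lineE a a1 b b1 : (line a a1 b b1).1 * a + (line a a1 b b1).2 = b.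
  by rewrite /= addrC subrK.
have lineE1 a a1 b b1 : a1 != a ->
    (line a a1 b b1).1 * a1 + (line a a1 b b1).2 = b1.
  by move=> a1a /=; field; rewrite subr_eq0.
pose S := [fset t in A `*` (A `*` A) | t.2.1 != t.1].
pose f (t : R * (R * R)) := (t.2.2 - t.1) / (t.2.1 - t.1).
pose l_ (p : (R * (R * R)) * (R * (R * R))) :=
  line p.1.1 p.1.2.1 p.2.1 p.2.2.1.
pose C := [fset p in S `*` S | f p.1 == f p.2].
have lineE2 p : p \in C -> (l_ p).1 * p.1.2.2 + (l_ p).2 = p.2.2.2.
  case: p => [[a [a1 a2]] [b [b1 b2]]]; rewrite !inE /=.
  move=> /andP[/andP[/andP[_ a1a] /andP[_ b1b]] /eqP e].
  have b10 : b1 - b != 0 by rewrite subr_eq0.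
  have a10 : a1 - a != 0 by rewrite subr_eq0.
  have -> : b2 = (b1 - b) * f (a, (a1, a2)) + b by rewrite e /f /=; field.
  by rewrite /f /=; field.
have CP p : p \in C -> [/\
    [/\ p.1.1 \in A, p.1.2.1 \in A & p.1.2.2 \in A],
    [/\ p.2.1 \in A, p.2.2.1 \in A & p.2.2.2 \in A],
    p.1.2.1 != p.1.1 & p.2.2.1 != p.2.1].
  rewrite !inE /= => /andP[/andP[/andP[/and3P[-> -> ->] ->]]].
  by move=> /andP[/and3P[-> -> ->] ->].
pose L := l_ @` C.
exists L; split.
  move=> _ /imfsetP[p /= /CP[[aA a1A a2A] [bA b1A b2A] a1a b1b] ->].
  split; first by rewrite /= mulf_neq0 ?invr_eq0 ?subr_eq0.
  have <- : #|` [fset p.1.2.1; p.1.1]| = 2%N by rewrite cardfs2 a1a.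
  apply: fsubset_leq_card; apply/fsubsetP => _ /fset2P[]->.
    by rewrite /line_fset in_fset inE /= a1A lineE1.
  by rewrite /line_fset in_fset inE /= aA lineE.
have -> : (#|` A| * (#|` A|.-1 * #|` A|))%N = #|` S|.
  rewrite (cardfs_sep_pair A (A `*` A) (fun a q => q.1 != a)).
  rewrite -sum_fset_const big_seq [RHS]big_seq; apply: eq_bigr => a aA.
  have -> : #|` A|.-1 = #|` A `\ a| by rewrite (cardfsD1 a A) aA.
  rewrite -cardfs_prod; congr #|` _|; apply/fsetP => q.
  by rewrite !inE /=; case: (q.1 == a); rewrite //= ?andbF ?andbT.
apply: leq_trans (card_fibers_sqr S f) _; apply: leq_mul.
  apply: fsubset_leq_card; apply/fsubsetP => _ /imfsetP[[a [a1 a2]] /= + ->].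
  rewrite !inE /= => /andP[/and3P[aA a1A a2A] a1a].
  by apply/ratio_setP; exists a, a1, a2.
rewrite -/C.
have -> : (\sum_(l <- L) #|` line_fset A l| ^ 3 =
    #|` [fset q in L `*` (A `*` (A `*` A)) |
      q.2 \in line_fset A q.1 `*` (line_fset A q.1 `*` line_fset A q.1)]|)%N.
  rewrite (cardfs_sep_pair L (A `*` (A `*` A)) (fun l t =>
    t \in line_fset A l `*` (line_fset A l `*` line_fset A l))).
  apply: eq_bigr => l _.
  have -> : (#|` line_fset A l| ^ 3 =
    #|` line_fset A l| * (#|` line_fset A l| * #|` line_fset A l|))%N by ring.
  rewrite -!cardfs_prod; congr #|` _|; apply/fsetP => t; rewrite !inE /=.
  by case: (t.1 \in A); case: (t.2.1 \in A); case: (t.2.2 \in A);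
    rewrite //= ?andbF.
(* The line and the first triple determine the second, which consists of the values of the line at
   the first. *)
apply: (@leq_card_fset_inj _ _ (fun p => (l_ p, p.1))).
  move=> p q pC qC pq.
  have el : l_ p = l_ q := congr1 fst pq.
  have e3 : p.1 = q.1 := congr1 snd pq.
  have [_ _ pa _] := CP _ pC; have [_ _ qa _] := CP _ qC.
  have := lineE2 _ pC; have := lineE2 _ qC.
  have := lineE1 p.1.1 p.1.2.1 p.2.1 p.2.2.1 pa.
  have := lineE1 q.1.1 q.1.2.1 q.2.1 q.2.2.1 qa.
  have := lineE p.1.1 p.1.2.1 p.2.1 p.2.2.1.
  have := lineE q.1.1 q.1.2.1 q.2.1 q.2.2.1.
  rewrite -/(l_ p) -/(l_ q) el e3.
  move: p q {pC qC pa qa pq el} e3.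
  by move=> [p1 [x [y z]]] [q1 [x' [y' z']]] /= -> -> -> -> -> -> ->.
move=> p pC; have [[aA a1A a2A] [bA b1A b2A] a1a b1b] := CP _ pC.
rewrite in_fset inE /= !in_fsetM /= aA a1A a2A in_imfset //=.
rewrite /line_fset !in_fset !inE /= aA a1A a2A /=.
by rewrite lineE lineE1// lineE2// bA b1A b2A.
Qed.

Lemma card_ratio_set_lower (R : realType) (A : {fset R}) : (2 <= #|` A|)%N ->
  (#|` A|%:R ^+ 2 <= 4096 * #|` ratio_set A|%:R * log2 #|` A|%:R :> R).
Proof.
move=> A2; have [L [L2]] := card_triples_ratio A2; rewrite -(ler_nat R).
have := sum_line_cubes L2.
have [n nE] : exists n, #|` A| = n.+1 by exists #|` A|.-1; lia.
have := sum_inv_le_ln R n; rewrite -nE.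
set H := \sum_(_ <= _ < _) _; set T := \sum_(_ <- _) _.
rewrite !(natrX, natrM).
have := A2; rewrite -(ler_nat R).
have -> : #|` A|.-1%:R = #|` A|%:R - 1 :> R by rewrite nE -natr1 addrK.
set a := #|` A|%:R; set r := #|` ratio_set A|%:R => a2 Hln TH aT.
have ln2 : 0 < ln 2 :> R by rewrite ln_gt0// ltr1n.
have ln21 : ln 2 <= 1 :> R.
  by have := @le_ln1Dx R 1; rewrite -[1 + 1]/2; apply; lra.
have lna : ln 2 <= ln a by rewrite ler_ln ?posrE; lra.
(* [H] is at most [1 + ln a], and both terms are at most [log2 a] because [2 <= a] and
   [ln 2 <= 1]. *)
have H2 : H <= 2 * log2 a.
  have : 1 <= log2 a by rewrite /log2 ler_pdivlMr// mul1r.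
  have : ln a <= log2 a by rewrite /log2 ler_pdivlMr//; nra.
  lra.
have r0 : 0 <= r by rewrite /r ler0n.
have a40 : 0 < a ^+ 4 by rewrite exprn_gt0//; lra.
have main : a ^+ 4 * (a - 1) ^+ 2 <= a ^+ 4 * (r * (486 * (2 * log2 a))).
  have -> : a ^+ 4 * (a - 1) ^+ 2 = (a * ((a - 1) * a)) ^+ 2 by ring.
  apply: le_trans aT _.
  have -> : a ^+ 4 * (r * (486 * (2 * log2 a))) = r * (486 * a ^+ 4 * (2 * log2 a)).
    by ring.
  rewrite ler_wpM2l// (le_trans TH)// ler_wpM2l// mulr_ge0//; lra.
move: main; rewrite ler_pM2l// => main.
(* Here [a <= 2 (a - 1)]; the constant becomes [4 * 486 * 2 = 3888 <= 4096]. *)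
have : a ^+ 2 <= 4 * (a - 1) ^+ 2 by nra.
have : 0 <= r * log2 a by rewrite mulr_ge0// /log2 divr_ge0//; lra.
lra.
Qed.

(** * Fractional powers and the final bounds *)

Lemma powR_exprn (R : realType) (x r : R) (n m : nat) :
  0 <= x -> r * n%:R = m%:R -> (x `^ r) ^+ n = x ^+ m.
Proof. by move=> x0 e; rewrite -powR_mulrn ?powR_ge0// -powRrM e powR_mulrn. Qed.

(** Twelfth roots turn the exponents 10 and 3 into 5/6 and 1/4, and [2 ^ 22 <= 4 ^ 12]. *)
Lemma le_root12 (R : realType) (d r t : nat) :
  (d ^ 10 * r ^ 3 <= 2 ^ 22 * t ^ 12)%N ->
  1 / 4 * d%:R `^ (5 / 6) * r%:R `^ (1 / 4) <= t%:R :> R.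
Proof.
rewrite -(ler_nat R) !(natrX, natrM) => h.
rewrite -(@ler_pXn2r _ 12) ?nnegrE ?ler0n ?mulr_ge0 ?powR_ge0//.
rewrite 2!exprMn (@powR_exprn _ _ _ 12 10) ?ler0n//; last by field.
rewrite (@powR_exprn _ _ _ 12 3) ?ler0n//; last by field.
have : 0 <= t%:R ^+ 12 :> R by rewrite exprn_ge0.
move: h; rewrite -mulrA; set u := _ * _; set v := t%:R ^+ 12; lra.
Qed.

Theorem theorem20 (R : realType) :
  exists2 c : R, 0 < c &
  forall A : {fset R}, (2 <= #|` A|)%N ->
  let D := diff_set A A in
  let cA : R := #|` A|%:R in
  let cD : R := #|` D|%:R in
  let cR : R := #|` ratio_set A|%:R in
  let cDD : R := #|` prod_set D D|%:R in
  let cDqD : R := #|` quot_set D D|%:R in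
  [/\ c * (cD `^ (5 / 6)) * (cR `^ (1 / 4)) <= cDD /\
      c * (cD `^ (5 / 6)) * (cR `^ (1 / 4)) <= cDqD,
      c * (cD `^ (5 / 6)) * (cA `^ (1 / 2)) * (log2 cA `^ (- (1 / 4)))
        <= (cD `^ (5 / 6)) * (cR `^ (1 / 4)) &
      c * (cD `^ (1 + 1 / 12)) * (log2 cD `^ (- (1 / 4))) <= cDD /\
      c * (cD `^ (1 + 1 / 12)) * (log2 cD `^ (- (1 / 4))) <= cDqD].
Proof.
(* [1/32] is the [1/4] from the twelfth root times the [1/8] of [ratioP]. *)
exists (1 / 32); first by lra.
move=> A A2 D cA cD cR cDD cDqD.
have prodP : 1 / 4 * cD `^ (5 / 6) * cR `^ (1 / 4) <= cDD.
  exact: le_root12 (card_diff_set_prod A2).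
have quotP : 1 / 4 * cD `^ (5 / 6) * cR `^ (1 / 4) <= cDqD.
  exact: le_root12 (card_diff_set_quot A2).
have cA2 : 2 <= cA by rewrite ler_nat.
have cAD : cA <= cD by rewrite ler_nat; exact: leq_card_diff_set.
have cDA : cD <= cA ^+ 2 by rewrite -natrX ler_nat; exact: card_diff_set_leq.
have ln2 : 0 < ln 2 :> R by rewrite ln_gt0// ltr1n.
have logA : 0 < log2 cA by rewrite divr_gt0// ln_gt0; lra.
have logAD : log2 cA <= log2 cD.
  by rewrite /log2 ler_pM2r ?invr_gt0// ler_ln ?posrE; lra.
have logD := lt_le_trans logA logAD.
pose x := cA `^ (1 / 2) * log2 cA `^ (- (1 / 4)).
(* Fourth root of the lower bound on [|R[A]|], with [8 ^ 4 = 4096]. *)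
have ratioP : 1 / 8 * x <= cR `^ (1 / 4).
  rewrite -(@ler_pXn2r _ 4) ?nnegrE ?mulr_ge0 ?powR_ge0//.
  rewrite exprMn [x ^+ 4]exprMn (@powR_exprn _ cA _ 4 2) ?ler0n//; last by field.
  rewrite powRN exprVn (@powR_exprn _ (log2 cA) _ 4 1) ?(ltW logA)//; last by field.
  rewrite (@powR_exprn _ cR _ 4 1) ?ler0n//; last by field.
  rewrite !expr1 [leLHS]mulrA ler_pdivrMr//.
  have := card_ratio_set_lower A2; rewrite -/cA -/cR; lra.
have x0 : 0 <= x by rewrite mulr_ge0 ?powR_ge0.
have d0 : 0 <= cD `^ (5 / 6) by exact: powR_ge0.
have r0 : 0 <= cR `^ (1 / 4) by exact: powR_ge0.
have second : 1 / 32 * cD `^ (5 / 6) * x <= 1 / 4 * cD `^ (5 / 6) * cR `^ (1 / 4).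
  nra.
(* [|D| <= |A| ^ 2] gives [|D|^(1/4) <= |A|^(1/2)], [|A| <= |D|] compares the logarithms, and
   [1 + 1/12 = 5/6 + 1/4]. *)
have third : cD `^ (1 + 1 / 12) * log2 cD `^ (- (1 / 4)) <= cD `^ (5 / 6) * x.
  have -> : 1 + 1 / 12 = 5 / 6 + 1 / 4 :> R by field.
  rewrite powRD; last by apply/implyP => _; lra.
  rewrite -mulrA ler_wpM2l// ler_pM ?powR_ge0//.
    have -> : 1 / 2 = 2%:R * (1 / 4) :> R by field.
    rewrite [leRHS]powRrM powR_mulrn ?ler0n//.
    by apply: ge0_ler_powR; rewrite ?nnegrE ?ler0n ?exprn_ge0//; lra.
  rewrite !powRN lef_pV2 ?posrE ?powR_gt0//.
  by apply: ge0_ler_powR; rewrite ?nnegrE; lra.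
split.
- by split; apply: le_trans (_ : 1 / 4 * cD `^ (5 / 6) * cR `^ (1 / 4) <= _) => //; nra.
- by rewrite -mulrA -/x; nra.
- have : 1 / 32 * cD `^ (1 + 1 / 12) * log2 cD `^ (- (1 / 4)) <=
      1 / 4 * cD `^ (5 / 6) * cR `^ (1 / 4).
    by rewrite -mulrA; lra.
  by split; lra.
Qed.
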